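(* Let $d\geqslant 5$ be an odd integer and let $n$ be a positive integer. Then $$\sum_{k=0}^{n-1}[2dk+1]\frac{(q;q^d)_k^d}{(q^d;q^d)_k^d}\,q^{\frac{d(d-3)k}{2}}\equiv \begin{cases} 0\pmod{\Phi_n(q)^2}, &\text{if } n\equiv -1\pmod{d},\\[5pt] 0\pmod{\Phi_n(q)^3}, &\text{if } n\equiv -\tfrac{1}{2}\pmod{d}.\end{cases}$$
   Context: Here $q$ is an indeterminate. Notation: $(a;q)_k=(1-a)(1-aq)\cdots(1-aq^{k-1})$ for $k\ge 1$, $(a;q)_0=1$ (so $(x;q^d)_k=\prod_{i=0}^{k-1}(1-xq^{di})$). For an integer $m$, $[m]=\frac{1-q^m}{1-q}$. $\Phi_n(q)$ is the $n$-th cyclotomic polynomial in $q$. The condition $n\equiv -\frac12\pmod d$ (with $d$ odd) means $2n\equiv -1\pmod d$. For a rational function $A(q)$ and a polynomial $P(q)$, $A(q)\equiv 0\pmod{P(q)}$ means that $A(q)=P(q)U(q)/V(q)$ with polynomials $U,V$ (over $\mathbb{Q}$), where $V$ is relatively prime to $P$ (factors that are powers of $q$ may be allowed in $V$). *)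

(* Defs.v *)
From mathcomp Require Import all_boot all_order all_algebra all_field.

Set Implicit Arguments.
Unset Strict Implicit.
Unset Printing Implicit Defensive.

Import GRing.Theory.
Local Open Scope ring_scope.

Notation ratfun := {fraction {poly rat}}.

Definition polyfun (p : {poly rat}) : ratfun := FracField.tofrac p.

Definition q : ratfun := polyfun 'X.

Definition qpoch (R : pzRingType) (a b : R) (k : nat) : R :=
  \prod_(i < k) (1 - a * b ^+ i).

Definition qint (m : int) : ratfun := (1 - q ^ m) / (1 - q).

(* The library's cyclotomic polynomials have integer coefficients. *)
Definition ratPhi (n : nat) : {poly rat} := map_poly intr 'Phi_n.

(* [V != 0] is implied by coprimality unless [P] is a nonzero constant.  Powers
   of 'X need no separate treatment: 'X is coprime to [ratPhi n ^+ k]. *)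
Definition eqmod0 (A : ratfun) (P : {poly rat}) : Prop :=
  exists U V : {poly rat},
    [/\ V != 0, coprimep V P & A = polyfun (P * U) / polyfun V].

(* Main.v *)
Require Import Defs.
From mathcomp Require Import all_boot all_order all_algebra all_field.
From mathcomp Require Import ring lra zify.

Set Implicit Arguments.
Unset Strict Implicit.
Unset Printing Implicit Defensive.

Import Order.TTheory GRing.Theory Num.Theory.
Local Open Scope ring_scope.

(** Write Q = q^d and u = q^n, so that u - 1 is divisible by Phi_n.  Up to the
    unit 1 / (1 - q), the sum is the value at (0, ..., 0) of the family
      T(e_1, ..., e_(d-1)) = sum_k (1 - q Q^(2k)) (q;Q)_k / (Q;Q)_k
                               Q^((d-3)k/2) g_k(e_1) ... g_k(e_(d-1)),
      g_k(e) = (q u^e;Q)_k / (Q u^(-e);Q)_k u^(-ek),   k = 0, ..., n-1,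
    a very-well-poised series with leading parameter q and the d-1 numerator
    parameters q u^(e_i) ([deformed_sum]).

    Modulo Phi_n^3 each g_k is a quadratic polynomial A + e B + e^2 C in e, with
    B divisible by Phi_n and C by Phi_n^2.  The same function g_k serves all the
    parameters, so when e_1 + ... + e_(d-1) = 0 the first-order terms of the
    product cancel, and T(e) = S + (sum of the e_i^2) W modulo Phi_n^3, with S
    and W independent of e ([deformed_sum_balanced]).  Hence two balanced zeros
    of T with different sums of squares force W, then S, and then
    T(0, ..., 0), to vanish modulo Phi_n^3 ([deformed_sum_level]).

    Such zeros exist ([deformed_sum_eq0]).  Let c = 1 if n = -1 modulo d and
    c = 2 if 2n = -1 modulo d, so that c n + 1 = d r, and put N = n - r.  The
    exponent e_1 = c - d turns q u^(e_1) into Q^(-N): the series then stops at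
    k = N, and its first factors become the weights w_k for which
      sum_(k <= N) w_k P(Q^(-k) + q Q^k) = 0   whenever deg P < N
    ([weight_orthogonal]).  The other factors of the summand amount to such a
    polynomial P: two exponents with sum c contribute degree r - 1, and the
    exponent (c + d(2-c))/2 alone contributes half of r - 1 + (2-c)n.  Together
    with (d-3)/2 pairs, the exponents sum to 0 and the degree is N - (d-3)/2,
    which is smaller than N because d >= 5.  Finally (f, c-f) is a legitimate
    pair for every integer f, and moving f changes the sum of squares.

    The argument yields divisibility by Phi_n^3 for both values of c. *)

(** * Filtered fields and second-order expansions *)

(** The abstract form of the filtration of the local ring at a prime P by the
    powers of P: [level j] stands for the fractions divisible by P^j, and
    [level 0] for the local ring itself. *)
Record filtration (K : fieldType) := Filtration {
  level :> nat -> K -> Prop;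
  level0 : forall j, level j 0;
  level1 : level 0 1;
  levelD : forall j x y, level j x -> level j y -> level j (x + y);
  levelN : forall j x, level j x -> level j (- x);
  levelM : forall i j x y, level i x -> level j y -> level (i + j) (x * y);
  levelW : forall i j x, (i <= j)%N -> level j x -> level i x
}.

Section Jets.
Variables (K : fieldType) (I : filtration K).

Lemma levelB j x y : I j x -> I j y -> I j (x - y).
Proof. by move=> hx hy; apply: levelD => //; apply: levelN. Qed.

Lemma levelMl j x y : I 0 x -> I j y -> I j (x * y).
Proof. exact: levelM. Qed.

Lemma levelMr j x y : I j x -> I 0 y -> I j (x * y).
Proof. by move=> hx hy; rewrite mulrC; apply: levelMl. Qed.

Lemma level_sum (T : Type) (r : seq T) (P : pred T) (f : T -> K) j :
  (forall i, P i -> I j (f i)) -> I j (\sum_(i <- r | P i) f i).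
Proof.
by move=> h; elim/big_rec: _ => [|i x Pi hx]; [apply: level0 | apply: levelD; auto].
Qed.

Lemma level_prod (T : Type) (r : seq T) (P : pred T) (f : T -> K) :
  (forall i, P i -> I 0 (f i)) -> I 0 (\prod_(i <- r | P i) f i).
Proof.
by move=> h; elim/big_rec: _ => [|i x Pi hx]; [apply: level1 | apply: levelMl; auto].
Qed.

Lemma levelX x m : I 0 x -> I 0 (x ^+ m).
Proof.
move=> h; elim: m => [|m IH]; first exact: level1.
by rewrite exprS; apply: levelMl.
Qed.

Lemma level_nat m : I 0 m%:R.
Proof.
elim: m => [|m IH]; first exact: level0.
by rewrite -addn1 natrD; apply: levelD => //; apply: level1.
Qed.

Lemma level_int e : I 0 e%:~R.
Proof.
case: e => m; first exact: level_nat.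
by rewrite NegzE mulrNz; apply: levelN; apply: level_nat.
Qed.

(** Taylor expansion to second order of a function of an integer e, with error of
    third order uniformly in e.  Here e plays the role of a bounded variable, the
    smallness being carried by B and C. *)
Definition jet2 (F : int -> K) (A B C : K) :=
  [/\ I 0 A, I 1 B, I 2 C &
      forall e, I 3 (F e - (A + e%:~R * B + e%:~R ^+ 2 * C))].

Lemma jet2_level F A B C e : jet2 F A B C -> I 0 (F e).
Proof.
case=> hA hB hC /(_ e) hF; rewrite -(subrK (A + e%:~R * B + e%:~R ^+ 2 * C) (F e)).
have he := level_int e.
apply: levelD; first exact: levelW hF.
apply: levelD; first apply: levelD => //.
  by apply: levelMl => //; apply: levelW hB.
by apply: levelMl; [apply: levelX | apply: levelW hC].
Qed.

Lemma jet2_const c : I 0 c -> jet2 (fun=> c) c 0 0.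
Proof.
move=> hc; split=> //; try exact: level0.
by move=> e; rewrite !mulr0 !addr0 subrr; apply: level0.
Qed.

Lemma jet2D F G A B C A' B' C' : jet2 F A B C -> jet2 G A' B' C' ->
  jet2 (fun e => F e + G e) (A + A') (B + B') (C + C').
Proof.
move=> [hA hB hC hF] [hA' hB' hC' hG]; split; try exact: levelD.
move=> e; set x := e%:~R.
suff -> : F e + G e - (A + A' + x * (B + B') + x ^+ 2 * (C + C')) =
  (F e - (A + x * B + x ^+ 2 * C)) + (G e - (A' + x * B' + x ^+ 2 * C')).
  exact: levelD.
by ring.
Qed.

Lemma jet2M F G A B C A' B' C' : jet2 F A B C -> jet2 G A' B' C' ->
  jet2 (fun e => F e * G e) (A * A') (A * B' + B * A')
       (A * C' + B * B' + C * A').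
Proof.
move=> jF jG; move: (jF) (jG) => [hA hB hC hF] [hA' hB' hC' hG]; split.
- exact: levelMl.
- by apply: levelD; [apply: levelMl | apply: levelMr].
- apply: levelD; last exact: levelMr.
  by apply: levelD; [apply: levelMl | apply: (@levelM _ I 1 1)].
move=> e; have he := level_int e; set x := e%:~R in he *.
have hf : I 0 (A + x * B + x ^+ 2 * C).
  rewrite -[X in I 0 X](subKr (F e)); apply: levelB; first exact: jet2_level jF.
  exact: levelW (hF e).
have -> : F e * G e -
    (A * A' + x * (A * B' + B * A') + x ^+ 2 * (A * C' + B * B' + C * A')) =
  (F e - (A + x * B + x ^+ 2 * C)) * G e +
  (A + x * B + x ^+ 2 * C) * (G e - (A' + x * B' + x ^+ 2 * C')) +
  (x ^+ 3 * (B * C' + C * B') + x ^+ 4 * (C * C')) by ring.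
apply: levelD.
  apply: levelD; first by apply: levelMr => //; apply: jet2_level jG.
  exact: levelMl.
apply: levelD; apply: levelMl; try exact: levelX.
  by apply: levelD; [apply: (@levelM _ I 1 2) | apply: (@levelM _ I 2 1)].
by apply: (@levelW _ I 3 4) => //; apply: (@levelM _ I 2 2).
Qed.
Definition has_jet2 F := exists A B C, jet2 F A B C.

Lemma has_jet2_prod (T : Type) (r : seq T) (F : T -> int -> K) :
  (forall i, has_jet2 (F i)) -> has_jet2 (fun e => \prod_(i <- r) F i e).
Proof.
move=> h; elim: r => [|i r [A [B [C hr]]]].
  exists 1, 0, 0; case: (jet2_const (level1 I)) => *; split=> // e.
  by rewrite big_nil.
have [A' [B' [C' hi]]] := h i; do 3!eexists.
have [h1 h2 h3 h4] := jet2M hi hr; split; eauto.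
by move=> e; rewrite big_cons; apply: h4.
Qed.

Lemma has_jet2_ext F G : F =1 G -> has_jet2 F -> has_jet2 G.
Proof.
move=> FG [A [B [C [h1 h2 h3 h4]]]]; exists A, B, C; split=> // e.
by rewrite -FG.
Qed.

Lemma has_jet2M F G : has_jet2 F -> has_jet2 G ->
  has_jet2 (fun e => F e * G e).
Proof.
move=> [A [B [C h]]] [A' [B' [C' h']]].
by do 3!eexists; apply: jet2M h h'.
Qed.

Lemma has_jet2_affine c F : I 0 c -> has_jet2 F ->
  has_jet2 (fun e => 1 - c * F e).
Proof.
move=> hc [A [B [C h]]].
have h1 := jet2M (jet2_const (levelN hc)) h.
have := jet2D (jet2_const (level1 I)) h1.
move=> h2; apply: (@has_jet2_ext (fun e => 1 + - c * F e)).
  by move=> e; rewrite mulNr.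
by do 3!eexists; apply: h2.
Qed.

(** Any constant term can be replaced by the exact value at 0; for inversion this
    makes it a unit at no cost. *)
Lemma jet2_at0 F A B C : jet2 F A B C -> jet2 F (F 0) B C.
Proof.
move=> jF; have [hA hB hC hF] := jF; split=> //; first exact: jet2_level jF.
move=> e; have -> : F e - (F 0 + e%:~R * B + e%:~R ^+ 2 * C) =
   F e - (A + e%:~R * B + e%:~R ^+ 2 * C) -
   (F 0 - (A + 0%:~R * B + 0%:~R ^+ 2 * C)) by rewrite mulr0z; ring.
exact: levelB.
Qed.

(** Truncation of the geometric series of F = A (1 + e D + e^2 E) with D = B / A
    and E = C / A. *)
Lemma has_jet2V F : (forall e, F e != 0) -> (forall e, I 0 (F e)^-1) ->
  has_jet2 F -> has_jet2 (fun e => (F e)^-1).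
Proof.
move=> F0 FV [A0 [B [C /jet2_at0 jF]]]; have [hA hB hC hF] := jF.
set A := F 0 in hA hF *; have nA : A != 0 by apply: F0.
have hV : I 0 A^-1 by apply: FV.
pose D := A^-1 * B; pose E := A^-1 * C.
have hD : I 1 D by apply: levelMl.
have hE : I 2 E by apply: levelMl.
exists A^-1, (- (A^-1 * D)), (A^-1 * (D ^+ 2 - E)).
have hD2 : I 2 (D ^+ 2) by rewrite expr2; apply: (@levelM _ I 1 1).
split=> //; first by apply: levelN; apply: levelMl.
  by apply: levelMl => //; apply: levelB.
move=> e; have := hF e; have he := level_int e; set x := e%:~R in he *.
set G := (X in F e - X) => hG.
have -> : (F e)^-1 - (A^-1 + x * - (A^-1 * D) + x ^+ 2 * (A^-1 * (D ^+ 2 - E))) =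
  (F e)^-1 * (- (F e - G) * (A^-1 * (1 - x * D + x ^+ 2 * (D ^+ 2 - E))) -
    (x ^+ 3 * (D * (D ^+ 2 - E) - E * D) + x ^+ 4 * (E * (D ^+ 2 - E)))).
  rewrite /G /D /E; move: (F0 e) => Fe0; field.
  by rewrite nA Fe0.
have h1 : I 0 (A^-1 * (1 - x * D + x ^+ 2 * (D ^+ 2 - E))).
  apply: levelMl => //; apply: levelD.
    by apply: levelB; [apply: level1 | apply: levelMl => //; apply: levelW hD].
  apply: levelMl; first exact: levelX.
  by apply: (@levelW _ I 0 2) => //; apply: levelB.
apply: levelMl => //; apply: levelB.
  by apply: levelMr => //; apply: levelN.
apply: levelD; apply: levelMl; try exact: levelX.
  apply: levelB; first by apply: (@levelM _ I 1 2) => //; apply: levelB.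
  exact: (@levelM _ I 2 1).
by apply: (@levelW _ I 3 4) => //; apply: (@levelM _ I 2 2) => //; apply: levelB.
Qed.

(** Truncation of the binomial series of (1 + t)^e, where e(e-1)/2 has been split
    into powers of e. *)
Lemma jet2_exp u : u != 0 -> I 0 u -> I 0 u^-1 -> I 1 (u - 1) ->
  2%:R != 0 :> K -> I 0 2%:R^-1 ->
  has_jet2 (fun e : int => u ^ e).
Proof.
move=> u0 hu huV; set t := u - 1 => ht n2 h2.
have ht2 : I 2 (t ^+ 2 * 2%:R^-1).
  by apply: levelMr => //; rewrite expr2; apply: (@levelM _ I 1 1).
have ht3 : I 3 (t ^+ 3) by rewrite exprS expr2; apply: (@levelM _ I 1 2) => //;
  apply: (@levelM _ I 1 1).
exists 1, (t - t ^+ 2 * 2%:R^-1), (t ^+ 2 * 2%:R^-1).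
split=> //; first exact: level1.
  by apply: levelB => //; apply: levelW ht2.
pose J (e : int) := 1 + e%:~R * (t - t ^+ 2 / 2%:R) + e%:~R ^+ 2 * (t ^+ 2 / 2%:R).
(* J satisfies the recursion of u ^ e up to third order, which carries the
   congruence up and down from e = 0 *)
have step e : I 3 (u * J e - J (e + 1)).
  have -> : u * J e - J (e + 1) = e%:~R * ((e%:~R - 1) / 2%:R) * t ^+ 3.
    rewrite /J intrD -[u](subrK 1) -/t; field; exact: n2.
  apply: levelMl => //; apply: levelMl; first exact: level_int.
  apply: levelMl => //; apply: levelB; [exact: level_int | exact: level1].
move=> e; rewrite -/(J e); elim/int_rect: e => [|m IH|m IH].
- have -> : u ^ 0 - J 0 = 0 by rewrite /J expr0z mulr0z; ring.
  exact: level0.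
- have -> : u ^ m.+1 - J m.+1 = u * (u ^ m - J m) + (u * J m - J (m%:Z + 1)).
    rewrite -[m.+1]addn1 PoszD expfzDr // expr1z; ring.
  by apply: levelD => //; apply: levelMl.
have -> : u ^ (- m.+1%:Z) - J (- m.+1%:Z) = u^-1 * ((u ^ (- m%:Z) - J (- m%:Z))
    - (u * J (- m.+1%:Z) - J (- m.+1%:Z + 1))).
  have -> : - m%:Z = - m.+1%:Z + 1 by lia.
  rewrite expfzDr // expr1z; field; exact: u0.
by apply: levelMl => //; apply: levelB.
Qed.

Definition psum1 (es : seq int) : int := \sum_(e <- es) e.
Definition psum2 (es : seq int) : int := \sum_(e <- es) e ^+ 2.

(** The product is symmetric in the exponents, so that to second order it involves
    them only through psum1, psum2 and the second elementary symmetric function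
    (psum1^2 - psum2) / 2. *)
Lemma jet2_multiprod F A B C m : jet2 F A B C -> 2%:R != 0 :> K ->
  forall es, size es = m.+2 ->
  I 3 (\prod_(e <- es) F e - (A ^+ m.+2 + (psum1 es)%:~R * (A ^+ m.+1 * B)
     + (psum2 es)%:~R * (A ^+ m.+1 * C)
     + (((psum1 es)%:~R ^+ 2 - (psum2 es)%:~R) / 2%:R) * (A ^+ m * B ^+ 2))).
Proof.
move=> jF n2; have [hA hB hC hF] := jF.
have hX k : I 0 (A ^+ k) by apply: levelX.
have hBB : I 2 (B ^+ 2) by rewrite expr2; apply: (@levelM _ I 1 1).
have hBC : I 3 (B * C) by apply: (@levelM _ I 1 2).
have hCC : I 3 (C * C) by apply: (@levelW _ I 3 4) => //; apply: (@levelM _ I 2 2).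
have hBBB : I 3 (B ^+ 2 * B) by apply: (@levelM _ I 2 1).
have hBBC : I 3 (B ^+ 2 * C).
  by apply: (@levelW _ I 3 4) => //; apply: (@levelM _ I 2 2).
pose f (e : int) := A + e%:~R * B + e%:~R ^+ 2 * C.
have hf e : I 0 (f e).
  have he := level_int e; apply: levelD; first apply: levelD => //.
    by apply: levelMl => //; apply: levelW hB.
  by apply: levelMl; [apply: levelX | apply: levelW hC].
elim: m => [|m IH] [//|e es] /= [sz].
  case: es sz => [//|e' [|//]] _; rewrite /psum1 /psum2 !big_cons !big_nil !addr0.
  rewrite !intrD !rmorphXn.
  have he := level_int e; have he' := level_int e'.
  set x := e%:~R in he *; set y := e'%:~R in he' *.
  have -> : F e * (F e' * 1) - (A ^+ 2 + (x + y) * (A ^+ 1 * B) +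
      (x ^+ 2 + y ^+ 2) * (A ^+ 1 * C) +
      ((x + y) ^+ 2 - (x ^+ 2 + y ^+ 2)) / 2%:R * (A ^+ 0 * B ^+ 2)) =
    (F e - f e) * F e' + f e * (F e' - f e') +
    ((x * y ^+ 2 + y * x ^+ 2) * (B * C) + (x ^+ 2 * y ^+ 2) * (C * C)).
    rewrite /f -/x -/y; field; exact: n2.
  apply: levelD; first apply: levelD.
  - by apply: levelMr; [apply: hF | apply: jet2_level jF].
  - by apply: levelMl => //; apply: hF.
  by apply: levelD; apply: levelMl => //; first apply: levelD;
    apply: levelMl => //; apply: levelX.
have {IH} := IH es sz.
have hs := level_int (psum1 es); have ht := level_int (psum2 es).
have -> : psum1 (e :: es) = e + psum1 es by rewrite /psum1 big_cons.
have -> : psum2 (e :: es) = e ^+ 2 + psum2 es by rewrite /psum2 big_cons.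
rewrite big_cons !intrD rmorphXn; move: hs ht.
set s := (psum1 es)%:~R; set t := (psum2 es)%:~R; set P := \prod_(j <- es) _.
set T := (X in P - X) => hs ht hT.
have he := level_int e; set x := e%:~R in he *.
have hP : I 0 P by apply: level_prod => i _; apply: jet2_level jF.
(* w is an integer, a fact hidden by the division by 2 *)
pose w := (s ^+ 2 - t) / 2%:R.
have hw : I 0 w.
  rewrite /w /s /t /psum1 /psum2; elim: es {sz s t P T hs ht hT w hP} => [|a es IH].
    by rewrite !big_nil mulr0z expr0n subrr mul0r; apply: level0.
  rewrite !big_cons !intrD rmorphXn.
  set s := (\sum_(j <- es) j)%:~R in IH *.
  set t := (\sum_(j <- es) _)%:~R in IH *.
  have -> : ((a%:~R + s) ^+ 2 - (a%:~R ^+ 2 + t)) / 2%:R =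
     (s ^+ 2 - t) / 2%:R + a%:~R * s by field; exact: n2.
  by apply: levelD => //; apply: levelMl; apply: level_int.
have -> : F e * P - (A ^+ m.+3 + (x + s) * (A ^+ m.+2 * B) +
    (x ^+ 2 + t) * (A ^+ m.+2 * C) +
    ((x + s) ^+ 2 - (x ^+ 2 + t)) / 2%:R * (A ^+ m.+1 * B ^+ 2)) =
  (F e - f e) * P + f e * (P - T) +
  ((x * t + x ^+ 2 * s) * A ^+ m.+1 * (B * C) + x * w * A ^+ m * (B ^+ 2 * B) +
   x ^+ 2 * t * A ^+ m.+1 * (C * C) + x ^+ 2 * w * A ^+ m * (B ^+ 2 * C)).
  rewrite /f -/x /T /w !(exprS A); move: (A ^+ m) => a; field; exact: n2.
have hx2 : I 0 (x ^+ 2) by apply: levelX.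
have h m' a b : I 0 a -> I 3 b -> I 3 (a * A ^+ m' * b).
  by move=> ha hb; apply: levelMl => //; apply: levelMl.
apply: levelD; first apply: levelD.
- by apply: levelMr => //; apply: hF.
- exact: levelMl.
apply: levelD; first apply: levelD; first apply: levelD.
- by apply: h => //; apply: levelD; apply: levelMl.
- by apply: h => //; apply: levelMl.
- by apply: h => //; apply: levelMl.
by apply: h => //; apply: levelMl.
Qed.

(** This is where balance matters: with psum1 = 0 no first-order term is left. *)
Lemma jet2_balanced F m : has_jet2 F -> 2%:R != 0 :> K -> 
  exists S W, forall es, size es = m.+2 -> psum1 es = 0 ->
  I 3 (\prod_(e <- es) F e - (S + (psum2 es)%:~R * W)).
Proof.
move=> [A [B [C jF]]] n2.
exists (A ^+ m.+2), (A ^+ m.+1 * C - A ^+ m * B ^+ 2 / 2%:R) => es sz s0.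
have := jet2_multiprod jF n2 sz; rewrite s0 mulr0z.
congr (I 3 _); field; exact: n2.
Qed.
End Jets.

(** * Orthogonality of the well-poised weights *)
Section QPoch.
Variable K : fieldType.
Implicit Types a b Q : K.

Lemma qpoch0 a Q : qpoch a Q 0 = 1.
Proof. exact: big_ord0. Qed.

Lemma qpochS a Q k : qpoch a Q k.+1 = qpoch a Q k * (1 - a * Q ^+ k).
Proof. exact: big_ord_recr. Qed.

Lemma qpochSl a Q k : qpoch a Q k.+1 = (1 - a) * qpoch (a * Q) Q k.
Proof.
rewrite /qpoch big_ord_recl expr0 mulr1; congr (_ * _).
by apply: eq_bigr => i _; rewrite -mulrA -exprS.
Qed.

Lemma qpochD a Q j k : qpoch a Q (j + k) = qpoch a Q j * qpoch (a * Q ^+ j) Q k.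
Proof.
elim: k => [|k IH]; first by rewrite addn0 qpoch0 mulr1.
by rewrite addnS !qpochS IH exprD !mulrA.
Qed.

Lemma qpoch_neq0 a Q k :
  (forall i, (i < k)%N -> a * Q ^+ i != 1) -> qpoch a Q k != 0.
Proof.
by move=> h; apply/prodf_neq0 => i _; rewrite subr_eq0 eq_sym h.
Qed.

(** Both sides are the product over i < j + k; read as a formula for the quotient
    of two length-k products whose first arguments differ by Q^j, it shows that this
    quotient is a polynomial in Q^k of degree j. *)
Lemma qpoch_shift a Q j k :
  qpoch a Q j * qpoch (a * Q ^+ j) Q k = qpoch a Q k * qpoch (a * Q ^+ k) Q j.
Proof. by rewrite -!qpochD addnC. Qed.
End QPoch.

Section Nodes.
Variables (K : fieldType) (a Q : K).
Hypothesis Q0 : Q != 0.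

(** The q-quadratic lattice.  It is invariant under Q^k -> 1/(a Q^k), the symmetry
    of well-poised series. *)
Definition node (k : nat) : K := Q ^- k + a * Q ^+ k.

(** Up to a constant, weight N k is the inverse of the product of the differences
    node k - node j over j <= N, j <> k. *)
Definition weight (N k : nat) : K :=
  (1 - a * Q ^+ (2 * k)) * (qpoch a Q k * qpoch (Q ^- N) Q k)
  / (qpoch Q Q k * qpoch (a * Q ^+ N.+1) Q k) * Q ^+ (N * k).

(** The i-th factor on b pairs with the i-th factor from the end on b': the
    condition makes the coefficient of Q^(2k) in their product equal to a, so that
    the product is Q^k times an affine function of node k. *)
Lemma paired_factors b b' s : b * b' * Q ^+ s = a * Q ->
  exists2 gs : seq K, size gs = s &
    forall k, qpoch (b * Q ^+ k) Q s * qpoch (b' * Q ^+ k) Q s =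
              Q ^+ (s * k) * \prod_(g <- gs) (node k - g).
Proof.
move=> hb.
exists [seq b * Q ^+ i + b' * Q ^+ (s.-1 - i) | i : 'I_s <- enum 'I_s].
  by rewrite size_map size_enum_ord.
move=> k; rewrite big_map big_enum /=.
rewrite {2}/qpoch (reindex_inj rev_ord_inj) /= /qpoch -big_split /=.
rewrite mulnC exprM -{1}[s in (Q ^+ k) ^+ s]card_ord -prodr_const -big_split /=.
apply: eq_bigr => i _; have -> : (s - i.+1 = s.-1 - i)%N by lia.
have hi : b * b' * (Q ^+ i * Q ^+ (s.-1 - i)) = a.
  apply: (mulIf Q0); rewrite -hb -exprD -(mulrA (b * b')) -exprSr.
  congr (_ * _ ^+ _).
  by have := ltn_ord i; lia.
rewrite /node; move: hi; set x := Q ^+ i; set y := Q ^+ (s.-1 - i).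
have : Q ^+ k != 0 by rewrite expf_neq0.
by set z := Q ^+ k => z0 <-; field.
Qed.

Hypothesis Q1 : forall j, (0 < j)%N -> Q ^+ j != 1.
Hypothesis aQ1 : forall j, (0 < j)%N -> a * Q ^+ j != 1.

(** The weights telescope; the closed form of the partial sums contains the factor
    1 - Q^0 once m = N. *)
Lemma weight_sum N m : 
  \sum_(k < m.+1) weight N k =
  qpoch a Q m.+1 * qpoch (Q ^- N * Q) Q m
  / (qpoch Q Q m * qpoch (a * Q ^+ N.+1) Q m) * Q ^+ (N * m).
Proof.
have QN : Q ^+ N != 0 by rewrite expf_neq0.
elim: m => [|m IH].
  rewrite big_ord_recl big_ord0 /weight !qpochS !qpoch0 !muln0 !expr0; field.
  by rewrite oner_neq0.
rewrite big_ord_recr IH /= /weight.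
rewrite (qpochS a Q m.+1) (qpochSl (Q ^- N)) (qpochS Q) (qpochS (a * _)).
rewrite (qpochS (Q ^- N * Q)) [(2 * _)%N]mulnC (exprM _ m.+1) (mulnS N) exprD.
have n1 : qpoch Q Q m != 0 by apply: qpoch_neq0 => i _; rewrite -exprS Q1.
have n2 : qpoch (a * Q ^+ N.+1) Q m != 0.
  by apply: qpoch_neq0 => i _; rewrite -mulrA -exprD aQ1.
have n3 : 1 - Q * Q ^+ m != 0 by rewrite subr_eq0 eq_sym -exprS Q1.
have n4 : 1 - a * Q ^+ N.+1 * Q ^+ m != 0.
  by rewrite subr_eq0 eq_sym -mulrA -exprD aQ1.
rewrite (exprS Q m) (exprS Q N) in n2 n4 *; move: n1 n2 n3 n4 QN.
set A := qpoch a Q m.+1; set P := qpoch Q Q m; set R := qpoch (a * _) Q m.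
set S := qpoch (Q ^- N * Q) Q m.
set x := Q ^+ m; set y := Q ^+ N; set w := Q ^+ (N * m).
move=> n1 n2 n3 n4 QN; field.
by rewrite n1 n2 n3 n4 QN.
Qed.

Lemma weight_sum0 N : (0 < N)%N -> \sum_(k < N.+1) weight N k = 0.
Proof.
case: N => // N _; rewrite weight_sum (qpochS (_ * Q)).
have -> : Q ^- N.+1 * Q * Q ^+ N = 1.
  by rewrite -mulrA -exprS mulVf // expf_neq0.
by rewrite subrr !(mulr0, mul0r).
Qed.

(** Multiplication by node k - node N.+1 removes the last node from the lattice. *)
Lemma weight_node N k : 
  weight N.+1 k * (node k - node N.+1) =
  (1 - Q ^- N.+1) * (1 - a * Q ^+ N.+1) * weight N k.
Proof.
have QN : Q ^+ N != 0 by rewrite expf_neq0.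
have Qk : Q ^+ k != 0 by rewrite expf_neq0.
have n1 : qpoch Q Q k != 0 by apply: qpoch_neq0 => i _; rewrite -exprS Q1.
have n2 : qpoch (a * Q ^+ N.+1) Q k != 0.
  by apply: qpoch_neq0 => i _; rewrite -mulrA -exprD aQ1.
have n2' : qpoch (a * Q ^+ N.+2) Q k != 0.
  by apply: qpoch_neq0 => i _; rewrite -mulrA -exprD aQ1.
have e1 : qpoch (Q ^- N.+1) Q k * (1 - Q ^- N.+1 * Q ^+ k) =
          (1 - Q ^- N.+1) * qpoch (Q ^- N) Q k.
  rewrite -qpochS qpochSl; congr (_ * qpoch _ _ _).
  by rewrite exprS; field; rewrite Q0 QN.
have e2 : qpoch (a * Q ^+ N.+1) Q k * (1 - a * Q ^+ N.+1 * Q ^+ k) =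
          (1 - a * Q ^+ N.+1) * qpoch (a * Q ^+ N.+2) Q k.
  by rewrite -qpochS qpochSl; congr (_ * qpoch _ _ _); rewrite -mulrA -exprSr.
rewrite /weight /node (mulSn N) exprD.
transitivity ((1 - a * Q ^+ (2 * k)) * qpoch a Q k * Q ^+ (N * k) /
    (qpoch Q Q k * qpoch (a * Q ^+ N.+2) Q k * qpoch (a * Q ^+ N.+1) Q k) *
  (qpoch (Q ^- N.+1) Q k * (1 - Q ^- N.+1 * Q ^+ k)) *
  (qpoch (a * Q ^+ N.+1) Q k * (1 - a * Q ^+ N.+1 * Q ^+ k))).
  by field; rewrite Qk n1 n2 n2' expf_neq0.
rewrite e1 e2; field; rewrite n1 n2 n2' expf_neq0 //.
Qed.

(** A divided difference on N + 1 nodes kills polynomials of degree less than N.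
    Splitting node k - g as (node k - node N) + (node N - g) lowers the degree,
    and in the first term also N. *)
Lemma weight_orthogonal (gs : seq K) N : (size gs < N)%N ->
  \sum_(k < N.+1) weight N k * \prod_(g <- gs) (node k - g) = 0.
Proof.
elim: gs N => [|g gs IH] N /= hN.
  by rewrite -[RHS](weight_sum0 hN); apply: eq_bigr => k _; rewrite big_nil mulr1.
case: N hN => // N hN.
have -> : \sum_(k < N.+2) weight N.+1 k * \prod_(h <- g :: gs) (node k - h) =
  \sum_(k < N.+2) weight N.+1 k * (node k - node N.+1) *
     \prod_(h <- gs) (node k - h) +
  (node N.+1 - g) *
     \sum_(k < N.+2) weight N.+1 k * \prod_(h <- gs) (node k - h).
  rewrite mulr_sumr -big_split /=; apply: eq_bigr => k _; rewrite big_cons; ring.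
rewrite (IH N.+1); last exact: ltnW.
rewrite big_ord_recr /= subrr mulr0 mul0r addr0 mulr0 addr0.
transitivity ((1 - Q ^- N.+1) * (1 - a * Q ^+ N.+1) *
    \sum_(k < N.+1) weight N k * \prod_(h <- gs) (node k - h)).
  by rewrite mulr_sumr; apply: eq_bigr => k _; rewrite weight_node; ring.
by rewrite IH ?mulr0.
Qed.

(** f agrees on 0..N with a polynomial of degree t in the node, given by its leading
    coefficient and its roots. *)
Definition nodal (N t : nat) (f : nat -> K) :=
  exists2 c : K * seq K, size c.2 = t &
    forall k, (k <= N)%N -> f k = c.1 * \prod_(g <- c.2) (node k - g).

Lemma nodal_ext N s f g : (forall k, (k <= N)%N -> f k = g k) ->
  nodal N s f -> nodal N s g.
Proof. by move=> fg [cg sz hf]; exists cg => // k hk; rewrite -fg // hf. Qed.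

Lemma nodal1 N : nodal N 0 (fun=> 1).
Proof. by exists (1, [::]) => // k _; rewrite big_nil mulr1. Qed.

Lemma nodalM N s t f g : nodal N s f -> nodal N t g ->
  nodal N (s + t) (fun k => f k * g k).
Proof.
move=> [[c gs] /= hs hf] [[c' gs'] /= ht hg].
exists (c * c', gs ++ gs'); first by rewrite size_cat hs ht.
by move=> k hk /=; rewrite hf // hg // big_cat /=; ring.
Qed.

Lemma nodal_sum0 N t f : nodal N t f -> (t < N)%N ->
  \sum_(k < N.+1) weight N k * f k = 0.
Proof.
move=> [[c gs] /= hs hf] ht.
transitivity (c * \sum_(k < N.+1) weight N k * \prod_(g <- gs) (node k - g)).
  rewrite mulr_sumr; apply: eq_bigr => k _; rewrite hf; last by rewrite -ltnS.
  by ring.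
by rewrite weight_orthogonal ?mulr0 // hs.
Qed.

(** In well-poised notation the parameters b Q^s and b' Q^s have a Q over them
    equal to b' and b respectively, hence the crossed denominators. *)
Lemma nodal_pair N b b' s : b * b' * Q ^+ s = a * Q ->
  qpoch b Q s != 0 -> qpoch b' Q s != 0 ->
  (forall k, (k <= N)%N -> qpoch b Q k != 0) ->
  (forall k, (k <= N)%N -> qpoch b' Q k != 0) ->
  nodal N s (fun k => qpoch (b * Q ^+ s) Q k / qpoch b' Q k *
    (qpoch (b' * Q ^+ s) Q k / qpoch b Q k) / Q ^+ (s * k)).
Proof.
move=> hb ns ns' nk nk'; have [gs hs hg] := paired_factors hb.
exists ((qpoch b Q s * qpoch b' Q s)^-1, gs) => // k hk /=.
have := hg k; have := qpoch_shift b Q s k; have := qpoch_shift b' Q s k.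
have := nk k hk; have := nk' k hk; have : Q ^+ (s * k) != 0 by rewrite expf_neq0.
set A := qpoch (b * Q ^+ s) Q k; set B := qpoch b' Q k.
set C := qpoch (b' * Q ^+ s) Q k; set D := qpoch b Q k.
set E := qpoch (b * Q ^+ k) Q s; set F := qpoch (b' * Q ^+ k) Q s.
set P := \prod_(g <- gs) _; set x := Q ^+ _ => n1 n2 n3 h1 h2 h3.
have -> : P = E * F / x by rewrite h3; field.
have -> : E = qpoch b Q s * A / D by rewrite h2; field; exact: n3.
have -> : F = qpoch b' Q s * C / B by rewrite h1; field.
by field; rewrite ns ns' n1 n2 n3.
Qed.

(** One parameter suffices if it can be paired with itself: the first half of its
    2t factors is matched with the second half. *)
Lemma nodal_self_paired N b t : b ^+ 2 * Q ^+ (t + t) = a * Q ->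
  qpoch b Q (t + t) != 0 ->
  (forall k, (k <= N)%N -> qpoch b Q k != 0) ->
  nodal N t (fun k => qpoch (b * Q ^+ (t + t)) Q k / qpoch b Q k / Q ^+ (t * k)).
Proof.
move=> hb ns nk.
have [|gs hs hg] := @paired_factors b (b * Q ^+ t) t.
  by rewrite -hb exprD; ring.
exists ((qpoch b Q (t + t))^-1, gs) => // k hk /=.
have := hg k; have := qpoch_shift b Q (t + t) k; rewrite [in RHS]qpochD.
have -> : b * Q ^+ t * Q ^+ k = b * Q ^+ k * Q ^+ t by ring.
have := nk k hk; have : Q ^+ (t * k) != 0 by rewrite expf_neq0.
set A := qpoch (_ * Q ^+ (t + t)) Q k; set D := qpoch b Q k.
set E := qpoch (b * Q ^+ k) Q t; set F := qpoch (b * Q ^+ k * Q ^+ t) Q t.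
set P := \prod_(g <- gs) _; set x := Q ^+ (t * k) => n1 n2 h2 h3.
have -> : P = E * F / x by rewrite h3; field.
have -> : E * F = qpoch b Q (t + t) * A / D by rewrite h2; field.
by field; rewrite ns n1 n2.
Qed.
End Nodes.

(** * The deformed sum modulo the third step of the filtration *)
Section Deformation.
Variables (K : fieldType) (t : K) (n d p : nat).
Notation Q := (t ^+ d).

Definition factor (k : nat) (e : int) : K :=
  qpoch (t ^ (1 + n%:Z * e)) Q k / qpoch (t ^ (d%:Z - n%:Z * e)) Q k
  / t ^ (n%:Z * e * k%:Z).

Definition coeff (k : nat) : K :=
  (1 - t ^+ (2 * d * k + 1)) * (qpoch t Q k / qpoch Q Q k) * t ^+ (d * p * k).

(** Up to the factor 1 / (1 - t), the sum of the theorem corresponds to the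
    zero sequence es of length d - 1. *)
Definition deformed_sum (es : seq int) : K :=
  \sum_(k < n) coeff k * \prod_(e <- es) factor k e.

Lemma undeformed_sumE : d = (2 * p + 3)%N ->
  \sum_(0 <= k < n) (1 - t ^ (2 * d * k + 1)%N%:Z) / (1 - t)
     * (qpoch t Q k ^+ d / qpoch Q Q k ^+ d) * t ^+ ((d * (d - 3) * k) %/ 2)
  = (1 - t)^-1 * deformed_sum (nseq d.-1 0).
Proof.
move=> dE; rewrite big_mkord mulr_sumr; apply: eq_bigr => k _.
have -> : ((d * (d - 3) * k) %/ 2 = d * p * k)%N.
  have -> : (d - 3 = 2 * p)%N by lia.
  by rewrite mulnCA -mulnA mulKn.
have -> : \prod_(e <- nseq d.-1 0) factor k e = (qpoch t Q k / qpoch Q Q k) ^+ d.-1.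
  rewrite big_nseq iter_mulr_1 /factor mulr0 mul0r subr0 addr0 expr0z divr1.
  by rewrite expr1z -exprnP.
have -> : qpoch t Q k ^+ d / qpoch Q Q k ^+ d =
    qpoch t Q k / qpoch Q Q k * (qpoch t Q k / qpoch Q Q k) ^+ d.-1.
  by rewrite -exprS prednK ?expr_div_n //; lia.
by rewrite /coeff -exprnP [X in X * _ * _ = _]mulrC; ring.
Qed.

Hypothesis t0 : t != 0.
Hypothesis t1 : forall E : int, E != 0 -> t ^ E != 1.
Hypothesis n_gt1 : (1 < n)%N.
Hypothesis co_nd : coprime n d.

Lemma tzE (E : int) i : t ^ E * Q ^+ i = t ^ (E + (d * i)%N%:Z).
Proof. by rewrite -exprM exprnP -expfzDr. Qed.

(** Shifting by multiples of n does not affect which factors of a denominator are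
    divisible by Phi_n; those with i.+1 < n never are, since n is prime to d. *)
Lemma dvd_n_shift (e : int) i :
  (n%:Z %| d%:Z - n%:Z * e + (d * i)%N%:Z)%Z = (n %| i.+1)%N.
Proof.
have -> : d%:Z - n%:Z * e + (d * i)%N%:Z = n%:Z * (- e) + (d * i.+1)%N%:Z by lia.
rewrite rpredDl ?dvdz_mulr // dvdzE /= Gauss_dvdr //.
Qed.

Lemma shift_neq0 (e : int) i : ~~ (n %| i.+1)%N ->
  d%:Z - n%:Z * e + (d * i)%N%:Z != 0.
Proof. by apply: contra => /eqP h; rewrite -(dvd_n_shift e) h dvdz0. Qed.

Lemma ndvd_small i k : (k < n)%N -> (i < k)%N -> ~~ (n %| i.+1)%N.
Proof. by move=> kn ik; rewrite gtnNdvd // (leq_trans _ kn). Qed.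

Lemma denom_neq0 (e : int) k : (k < n)%N ->
  qpoch (t ^ (d%:Z - n%:Z * e)) Q k != 0.
Proof.
move=> kn; apply: qpoch_neq0 => i ik; rewrite tzE.
by apply: t1; apply: shift_neq0; apply: ndvd_small kn ik.
Qed.

Section Congruence.
Variable I : filtration K.
Hypothesis It : I 0 t.
Hypothesis ItV : I 0 t^-1.
Hypothesis I1t : forall m, ~~ (n %| m)%N -> I 0 (1 - t ^+ m)^-1.
Hypothesis Iu : I 1 (t ^+ n - 1).
Hypothesis natK : forall m, (0 < m)%N -> m%:R != 0 :> K.
Hypothesis InatV : forall m, (0 < m)%N -> I 0 (m%:R^-1).

Lemma level_tz (E : int) : I 0 (t ^ E).
Proof.
case: E => m; first exact: levelX.
by rewrite NegzE -exprz_inv; apply: levelX.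
Qed.

Lemma level_1tz E : I 0 (1 - t ^ E).
Proof. by apply: levelB; [apply: level1 | apply: level_tz]. Qed.

Lemma level_1tzV (E : int) : ~~ (n%:Z %| E)%Z -> I 0 (1 - t ^ E)^-1.
Proof.
case: E => m; rewrite dvdzE /=; first exact: I1t.
move=> nm; rewrite NegzE -invr_expz -exprnP.
have y0 : t ^+ m.+1 != 0 by rewrite expf_neq0.
have y1 : t ^+ m.+1 != 1 by apply: (t1 (E := m.+1)).
have y2 : 1 - t ^+ m.+1 != 0 by rewrite subr_eq0 eq_sym.
have y3 : t ^+ m.+1 - 1 != 0 by rewrite subr_eq0.
have -> : (1 - (t ^+ m.+1)^-1)^-1 = - (t ^+ m.+1 * (1 - t ^+ m.+1)^-1).
  by field; rewrite y0 y2 y3.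
by apply: levelN; apply: levelMl; [apply: levelX | apply: I1t].
Qed.

Lemma coeff_level k : (k < n)%N -> I 0 (coeff k).
Proof.
move=> kn; apply: levelMl; last exact: levelX.
apply: levelMl; first exact: (level_1tz (2 * d * k + 1)%N).
apply: levelMl.
  apply: level_prod => i _; rewrite -[t in t * _]expr1z tzE.
  exact: level_1tz.
rewrite -[Q in qpoch Q]/(t ^ d%:Z).
rewrite /qpoch -prodfV; apply: level_prod => i _; rewrite tzE; apply: level_1tzV.
have := dvd_n_shift 0 i; rewrite mulr0 subr0 => ->.
exact: ndvd_small kn (ltn_ord i).
Qed.

Lemma has_jet2_tz : has_jet2 I (fun e => t ^ (n%:Z * e)).
Proof.
apply: (@has_jet2_ext _ _ (fun e => (t ^+ n) ^ e)).
  by move=> e; rewrite exprnP exprz_exp.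
apply: jet2_exp => //.
- by rewrite expf_neq0.
- exact: levelX.
- by rewrite -exprVn; apply: levelX.
- exact: natK.
exact: InatV.
Qed.

Lemma has_jet2_tzN : has_jet2 I (fun e => t ^ (- (n%:Z * e))).
Proof.
apply: (@has_jet2_ext _ _ (fun e => (t ^ (n%:Z * e))^-1)).
  by move=> e; rewrite invr_expz.
apply: has_jet2V has_jet2_tz => e; first by rewrite expfz_neq0.
by rewrite invr_expz; apply: level_tz.
Qed.

Lemma factor_jet k : (k < n)%N -> has_jet2 I (factor k).
Proof.
move=> kn; have hQ i : I 0 (Q ^+ i) by apply: levelX; apply: levelX.
apply: has_jet2M; first apply: has_jet2M.
- apply: has_jet2_prod => i.
  apply: (@has_jet2_ext _ _ (fun e => 1 - (t * Q ^+ i) * t ^ (n%:Z * e))).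
    by move=> e; rewrite expfzDr // expr1z; ring.
  by apply: has_jet2_affine has_jet2_tz; apply: levelMl.
- apply: has_jet2V => [e|e|]; first exact: denom_neq0.
    rewrite /qpoch -prodfV; apply: level_prod => i _; rewrite tzE; apply: level_1tzV.
    by rewrite dvd_n_shift; apply: ndvd_small kn (ltn_ord i).
  apply: has_jet2_prod => i.
  apply: (@has_jet2_ext _ _ (fun e => 1 - (Q * Q ^+ i) * t ^ (- (n%:Z * e)))).
    by move=> e; rewrite expfzDr // -exprnP; ring.
  by apply: has_jet2_affine has_jet2_tzN; apply: levelMl => //; apply: levelX.
apply: (@has_jet2_ext _ _ (fun e => \prod_(i < k) t ^ (- (n%:Z * e)))).
  by move=> e; rewrite prodr_const card_ord exprnP exprz_exp mulNr invr_expz.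
by apply: has_jet2_prod => i; apply: has_jet2_tzN.
Qed.

Lemma deformed_sum_balanced m : exists S W, forall es,
  size es = m.+2 -> psum1 es = 0 -> I 3 (deformed_sum es - (S + (psum2 es)%:~R * W)).
Proof.
have H n' : (n' <= n)%N -> exists SW : nat -> K * K,
  forall k, (k < n')%N -> forall es,
  size es = m.+2 -> psum1 es = 0 ->
  I 3 (\prod_(e <- es) factor k e - ((SW k).1 + (psum2 es)%:~R * (SW k).2)).
  elim: n' => [|n' IH] hn'; first by exists (fun=> (0, 0)).
  have [SW hSW] := IH (ltnW hn').
  have [S [W hW]] := jet2_balanced m (factor_jet hn') (natK (isT : (0 < 2)%N)).
  exists (fun k => if (k < n')%N then SW k else (S, W)) => k.
  rewrite ltnS leq_eqVlt; case: ltnP => hk; first by move=> _; apply: hSW.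
  by rewrite orbF => /eqP ->; apply: hW.
have [SW hSW] := H n (leqnn n).
exists (\sum_(k < n) coeff k * (SW k).1), (\sum_(k < n) coeff k * (SW k).2).
move=> es sz s0.
rewrite /deformed_sum mulr_sumr -big_split -sumrB /=.
apply: level_sum => k _.
have -> : coeff k * \prod_(e <- es) factor k e -
  (coeff k * (SW k).1 + (psum2 es)%:~R * (coeff k * (SW k).2)) =
  coeff k * (\prod_(e <- es) factor k e - ((SW k).1 + (psum2 es)%:~R * (SW k).2)).
  by ring.
by apply: levelMl; [apply: coeff_level | apply: hSW].
Qed.

(** The two zeros give two linear equations S + psum2 W = 0 modulo I 3 with distinct
    coefficients, whose difference is an invertible multiple of W. *)
Lemma deformed_sum_level m es es' : size es = m.+2 -> size es' = m.+2 ->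
  psum1 es = 0 -> psum1 es' = 0 -> psum2 es < psum2 es' ->
  deformed_sum es = 0 -> deformed_sum es' = 0 ->
  I 3 (deformed_sum (nseq m.+2 0)).
Proof.
move=> sz sz' s0 s0' lt T0 T0'.
have [S [W hSW]] := deformed_sum_balanced m.
have h := hSW _ sz s0; have h' := hSW _ sz' s0'.
have h0 : I 3 (deformed_sum (nseq m.+2 0) - S).
  have := hSW (nseq m.+2 0) (size_nseq _ _).
  have z1 : psum1 (nseq m.+2 0) = 0.
    by rewrite /psum1 big1_seq // => e /andP[_]; rewrite mem_nseq => /andP[_ /eqP->].
  have z2 : psum2 (nseq m.+2 0) = 0.
    by rewrite /psum2 big1_seq // => e /andP[_]; rewrite mem_nseq => /andP[_ /eqP->].
  by rewrite z1 z2 mulr0z mul0r addr0; apply.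
have hW : I 3 W.
  have [j [j0 hj]] : exists j, (0 < j)%N /\ psum2 es' - psum2 es = j%:Z.
    by exists `|psum2 es' - psum2 es|%N; lia.
  have -> : W = j%:R^-1 * ((deformed_sum es - (S + (psum2 es)%:~R * W)) -
    (deformed_sum es' - (S + (psum2 es')%:~R * W))).
    rewrite T0 T0'.
    have -> : 0 - (S + (psum2 es)%:~R * W) - (0 - (S + (psum2 es')%:~R * W)) =
      (psum2 es' - psum2 es)%:~R * W by rewrite intrB; ring.
    by rewrite hj mulKf // natK.
  by apply: levelMl; [apply: InatV | apply: levelB].
rewrite -(subrK S (deformed_sum _)); apply: levelD => //.
have -> : S = - (deformed_sum es - (S + (psum2 es)%:~R * W)) - (psum2 es)%:~R * W.
  by rewrite T0; ring.
apply: levelB; first exact: levelN.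
by apply: levelMl => //; apply: level_int.
Qed.
End Congruence.

End Deformation.

(** * Exact zeros of the deformed sum *)

(** Notation: p pairs of exponents are used; c is the sum of each pair and is
    also the multiplier in c n = -1 modulo d; e is the self-paired exponent, and h
    the degree it contributes.  Taking l = 2 - c copies of n in the length
    2h = r - 1 + l n makes that length even whatever the parity of n. *)
Record shift_data (n d p c l r e h : nat) : Prop := ShiftData {
  sd_d : d = (2 * p + 3)%N;
  sd_p : (0 < p)%N;
  sd_c : (0 < c)%N;
  sd_cl : (c + l = 2)%N;
  sd_r : (d * r = c * n + 1)%N;
  sd_e : (2 * e = c + d * l)%N;
  sd_h : (2 * h + 1 = r + l * n)%N
}.

Section ShiftArithmetic.
Variables n d p c l r e h : nat.
Hypothesis SD : shift_data n d p c l r e h.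
Let dE := sd_d SD.
Let p_gt0 := sd_p SD.
Let c_gt0 := sd_c SD.
Let cl := sd_cl SD.
Let dr := sd_r SD.
Let e2E := sd_e SD.
Let hE := sd_h SD.
Notation N := (n - r)%N.

Lemma r_gt0 : (0 < r)%N.
Proof. by case: r dr => //; lia. Qed.

Lemma r_lt_n : (r < n)%N.
Proof.
have : (5 * r <= d * r)%N by rewrite leq_mul2r; lia.
have : (c * n <= 2 * n)%N by rewrite leq_mul2r; lia.
have := r_gt0; have : (r = 1)%N \/ (2 <= r)%N by have := r_gt0; lia.
case; last by lia.
move=> r1; move: dr; rewrite r1 muln1; case: n => [|[|n']]; lia.
Qed.

Lemma n_gt1 : (1 < n)%N.
Proof. by have := r_gt0; have := r_lt_n; lia. Qed.

Lemma coprime_n_d : coprime n d.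
Proof.
have h1 : coprime (c * n) (d * r) by rewrite dr addn1 coprimenS.
by move: h1; rewrite coprimeMl => /andP[_]; rewrite coprimeMr => /andP[].
Qed.

Lemma mul_d_N : (d * N)%N%:Z = d%:Z * n%:Z - c%:Z * n%:Z - 1.
Proof.
have := r_lt_n; rewrite mulnBr => rn.
rewrite -subzn; last by rewrite leq_mul2l ltnW ?orbT.
by rewrite dr; lia.
Qed.

Lemma mul_d_pred_r : (d * r.-1)%N%:Z = c%:Z * n%:Z + 1 - d%:Z.
Proof. by have := r_gt0; case: r dr => // r' /=; rewrite mulnS; lia. Qed.

(** The self-pairing condition (q^d / u^e)^2 Q^(2h) = q Q, written in exponents of q
    and divided by 2. *)
Lemma mul_d_h : (d * h + p + 1 = n * e)%N.
Proof.
have h1 : (d * (2 * h + 1) = d * (r + l * n))%N by rewrite hE.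
have h2 : (n * (2 * e) = n * (c + d * l))%N by rewrite e2E.
by move: h1 h2 dr dE; lia.
Qed.

End ShiftArithmetic.

Section Vanishing.
Variables (K : fieldType) (t : K) (n d p c l r e0 h : nat).
Hypothesis t0 : t != 0.
Hypothesis t1 : forall E : int, E != 0 -> t ^ E != 1.
Hypothesis SD : shift_data n d p c l r e0 h.
Let dE := sd_d SD.
Let p_gt0 := sd_p SD.
Let c_gt0 := sd_c SD.
Let cl := sd_cl SD.
Let dr := sd_r SD.
Let e2E := sd_e SD.
Let hE := sd_h SD.
Let r_gt0 := r_gt0 SD.
Let r_lt_n := r_lt_n SD.
Let n_gt1 := n_gt1 SD.
Let co_nd := coprime_n_d SD.
Let mul_d_N := mul_d_N SD.
Let mul_d_pred_r := mul_d_pred_r SD.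
Let mul_d_h := mul_d_h SD.
Notation Q := (t ^+ d).
Notation N := (n - r)%N.

(** The exponent e for which t^(1 + n e) = Q^(-N). *)
Definition leading : int := c%:Z - d%:Z.

Lemma factor_leading_eq0 k : (N < k)%N -> factor t n d k leading = 0.
Proof.
move=> hk; rewrite /factor.
suff -> : qpoch (t ^ (1 + n%:Z * leading)) Q k = 0 by rewrite !mul0r.
apply/eqP/prodf_eq0; exists (Ordinal hk) => //=; rewrite tzE //.
have -> : 1 + n%:Z * leading + (d * N)%N%:Z = 0 by rewrite mul_d_N /leading; ring.
by rewrite expr0z subrr.
Qed.

Lemma Q_neq0 : Q != 0. Proof. by rewrite expf_neq0. Qed.

Lemma t_pow_neq1 (j : nat) : (0 < j)%N -> t ^+ j != 1.
Proof. by move=> j0; apply: (t1 (E := j)); lia. Qed.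

Lemma Q_pow_neq1 j : (0 < j)%N -> Q ^+ j != 1.
Proof. by move=> j0; rewrite -exprM; apply: t_pow_neq1; rewrite muln_gt0; lia. Qed.

Lemma tQ_pow_neq1 j : (0 < j)%N -> t * Q ^+ j != 1.
Proof. by move=> j0; rewrite -exprM -exprS; apply: t_pow_neq1. Qed.

(** The power of t left over here is compensated by those in [factor_self_nodal]
    and [factor_pair_nodal]: d p + 1 = (p + 1) + p (2 p + 2). *)
Lemma coeff_factor_leading k : (k <= N)%N ->
  coeff t d p k * factor t n d k leading =
  weight t Q N k * t ^+ ((d * p + 1) * k).
Proof.
move=> hk; rewrite /coeff /factor /weight.
have -> : t ^ (1 + n%:Z * leading) = Q ^- N.
  by rewrite -exprM exprnN mul_d_N /leading; congr (_ ^ _); ring.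
have -> : t ^ (d%:Z - n%:Z * leading) = t * Q ^+ N.+1.
  rewrite -exprM -exprS exprnP; congr (_ ^ _).
  by rewrite mulnS -addn1 !PoszD mul_d_N /leading; ring.
have -> : t ^ (n%:Z * leading * k%:Z) = (Q ^+ (N * k) * t ^+ k)^-1.
  rewrite -exprM -exprD exprnN; congr (_ ^ _).
  by rewrite PoszD mulnA PoszM mul_d_N /leading; ring.
have -> : t ^+ (2 * d * k + 1) = t * Q ^+ (2 * k).
  by rewrite -exprM -exprS; congr (_ ^+ _); lia.
rewrite mulnDl mul1n exprD invrK.
have [n1 n2] : qpoch Q Q k != 0 /\ qpoch (t * Q ^+ N.+1) Q k != 0.
  split; apply: qpoch_neq0 => i _; first by rewrite -exprS Q_pow_neq1.
  by rewrite -mulrA -exprD tQ_pow_neq1.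
by field; rewrite n1 n2.
Qed.

Lemma factor_pair_nodal f :
  nodal t Q N r.-1 (fun k => factor t n d k f * factor t n d k (c%:Z - f) *
     t ^+ ((2 * p + 2) * k)).
Proof.
have hr := r_gt0; have hrn := r_lt_n.
have cond : t ^ (d%:Z - n%:Z * (c%:Z - f)) * t ^ (d%:Z - n%:Z * f) * Q ^+ r.-1 =
   t * Q.
  rewrite -expfzDr // tzE // -exprS exprnP; congr (_ ^ _).
  by rewrite -addn1 PoszD mul_d_pred_r; ring.
have den (e : int) k : (k < n)%N -> qpoch (t ^ (d%:Z - n%:Z * e)) Q k != 0.
  exact: (denom_neq0 t0 t1 n_gt1 co_nd).
have := @nodal_pair K t Q Q_neq0 N _ _ r.-1 cond.
move=> /(_ (den _ _ _) (den _ _ _)) H; have {H} := H _ _.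
have s0 : (r.-1 < n)%N by lia.
move=> /(_ s0 s0) H.
apply: nodal_ext (H _ _); last 2 first.
- by move=> k hk; apply: den; lia.
- by move=> k hk; apply: den; lia.
move=> k hk /=; rewrite /factor !tzE //.
have -> : d%:Z - n%:Z * (c%:Z - f) + (d * r.-1)%N%:Z = 1 + n%:Z * f.
  by rewrite mul_d_pred_r; ring.
have -> : d%:Z - n%:Z * f + (d * r.-1)%N%:Z = 1 + n%:Z * (c%:Z - f).
  by rewrite mul_d_pred_r; ring.
have hx : t ^+ ((2 * p + 2) * k) * Q ^+ (r.-1 * k) =
  t ^ (n%:Z * f * k%:Z) * t ^ (n%:Z * (c%:Z - f) * k%:Z).
  rewrite -exprM -exprD -expfzDr // exprnP; congr (_ ^ _).
  by rewrite (mulnA d) -mulnDl PoszM PoszD mul_d_pred_r dE !PoszD; ring.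
have := den (c%:Z - f) k; have := den f k.
have kn : (k < n)%N by lia.
move=> /(_ kn) n1 /(_ kn) n2.
have x0 : Q ^+ (r.-1 * k) != 0 by rewrite expf_neq0 ?Q_neq0.
have y0 E : t ^ E != 0 by rewrite expfz_neq0.
have -> : t ^+ ((2 * p + 2) * k) =
  t ^ (n%:Z * f * k%:Z) * t ^ (n%:Z * (c%:Z - f) * k%:Z) / Q ^+ (r.-1 * k).
  by rewrite -hx mulfK.
move: (y0 (n%:Z * f * k%:Z)) (y0 (n%:Z * (c%:Z - f) * k%:Z)) x0 n1 n2.
set y := t ^ _; set z := t ^ _; set x := Q ^+ (_ * _).
set A := qpoch _ Q k; set B := qpoch _ Q k; set C := qpoch _ Q k.
set D := qpoch _ Q k => hy hz hx0 n1 n2; field.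
by rewrite hy hz hx0 n1 n2.
Qed.

(** The self-paired length may exceed n, so that smallness of i is not available.
    A vanishing factor would give d j = e0 for some j, whence d would divide c,
    which is 1 or 2. *)
Lemma denom_self_neq0 k : qpoch (t ^ (d%:Z - n%:Z * e0%:Z)) Q k != 0.
Proof.
apply: qpoch_neq0 => i _; rewrite tzE //; apply: t1; apply/eqP => E0.
have E1 : (d * i.+1 = n * e0)%N.
  by move: E0; rewrite mulnS -PoszM; lia.
have : (n %| i.+1)%N.
  by rewrite -(Gauss_dvdr _ co_nd) E1 dvdn_mulr.
case/dvdnP => j ij; have ej : (d * j = e0)%N.
  apply/eqP; rewrite -(eqn_pmul2l (ltnW n_gt1)); apply/eqP.
  by rewrite -E1 ij mulnCA (mulnC j).
have : (d %| c)%N.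
  rewrite -(@dvdn_addl (d * l)) ?dvdn_mulr // -e2E -ej mulnCA dvdn_mulr //.
by move/(dvdn_leq c_gt0); lia.
Qed.

Lemma factor_self_nodal :
  nodal t Q N h (fun k => factor t n d k e0%:Z * t ^+ ((p + 1) * k)).
Proof.
have hdh := mul_d_h.
have cond : (t ^ (d%:Z - n%:Z * e0%:Z)) ^+ 2 * Q ^+ (h + h) = t * Q.
  rewrite expr2 -expfzDr // tzE // -exprS exprnP; congr (_ ^ _).
  by rewrite mulnDr -PoszM -hdh !PoszD -addn1 !PoszD dE; lia.
apply: nodal_ext (nodal_self_paired Q_neq0 cond _ _); last 2 first.
- exact: denom_self_neq0.
- by move=> k _; apply: denom_self_neq0.
move=> k hk /=; rewrite /factor tzE //.
have -> : d%:Z - n%:Z * e0%:Z + (d * (h + h))%N%:Z = 1 + n%:Z * e0%:Z.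
  by rewrite mulnDr -PoszM -hdh !PoszD dE; lia.
have -> : t ^ (n%:Z * e0%:Z * k%:Z) = t ^+ ((p + 1) * k) * Q ^+ (h * k).
  rewrite -exprM -exprD exprnP; congr (_ ^ _).
  by rewrite -!PoszM -hdh mulnA -mulnDl; congr (Posz (_ * _)); lia.
have n1 := denom_self_neq0 k.
have n2 : Q ^+ (h * k) != 0 by rewrite expf_neq0 ?Q_neq0.
have n3 : t ^+ ((p + 1) * k) != 0 by rewrite expf_neq0.
by field; rewrite n1 n2 n3.
Qed.

Definition paired (fs : seq int) : seq int :=
  flatten [seq [:: f; c%:Z - f] | f <- fs].

Lemma paired_nodal fs :
  nodal t Q N (size fs * r.-1) (fun k =>
    (\prod_(e <- paired fs) factor t n d k e) * t ^+ ((2 * p + 2) * size fs * k)).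
Proof.
elim: fs => [|f fs IH].
  apply: nodal_ext (nodal1 t Q N) => k _.
  by rewrite big_nil muln0 mul0n expr0 mulr1.
apply: nodal_ext (nodalM (factor_pair_nodal f) IH) => k _ /=.
have -> : ((2 * p + 2) * (size fs).+1 * k =
    (2 * p + 2) * k + (2 * p + 2) * size fs * k)%N by rewrite mulnS -mulnDl.
by rewrite !big_cons exprD; ring.
Qed.

Definition vanishing_seq fs := leading :: e0%:Z :: paired fs.

(** The total degree h + p (r - 1) equals N - p; this is where p > 0, that is
    d >= 5, is used. *)
Lemma deformed_sum_eq0 fs : size fs = p ->
  deformed_sum t n d p (vanishing_seq fs) = 0.
Proof.
move=> sz; have hr := r_lt_n.
have j := nodalM factor_self_nodal (paired_nodal fs).
have jlt : (h + size fs * r.-1 < N)%N.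
  rewrite sz; have : (d * r = 2 * (p * r) + 3 * r)%N by rewrite dE mulnDl mulnA.
  have : (p * r.-1 + p = p * r)%N by rewrite addnC -mulnS prednK ?r_gt0.
  have : c = 1%N /\ l = 1%N \/ c = 2%N /\ l = 0%N by lia.
  by case=> -[c1 l1]; move: dr hE; rewrite c1 l1; lia.
apply: etrans (nodal_sum0 Q_neq0 Q_pow_neq1 tQ_pow_neq1 j jlt).
rewrite /deformed_sum.
rewrite [RHS](big_ord_widen n (fun k => weight t Q N k *
  (factor t n d k e0%:Z * t ^+ ((p + 1) * k) *
   ((\prod_(e <- paired fs) factor t n d k e) *
    t ^+ ((2 * p + 2) * size fs * k)))) ); last by have := r_gt0; lia.
rewrite [LHS](bigID (fun k : 'I_n => (k < N.+1)%N)) /= [X in _ + X]big1 ?addr0.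
  apply: eq_bigr => k; rewrite ltnS => hk.
  rewrite !big_cons mulrA coeff_factor_leading // sz.
  have -> : ((d * p + 1) * k = (p + 1) * k + (2 * p + 2) * p * k)%N.
    by rewrite -mulnDl dE; congr (_ * _)%N; lia.
  by rewrite exprD; ring.
move=> k; rewrite -leqNgt => hk.
by rewrite !big_cons factor_leading_eq0 // mul0r mulr0.
Qed.

Lemma size_paired fs : size (paired fs) = (2 * size fs)%N.
Proof. by elim: fs => //= f fs ->; rewrite mulnS. Qed.

Lemma size_vanishing fs : size (vanishing_seq fs) = (2 * size fs).+2.
Proof. by rewrite /= size_paired. Qed.

Lemma psum1_vanishing fs : size fs = p -> psum1 (vanishing_seq fs) = 0.
Proof.
move=> sz.
have -> : psum1 (vanishing_seq fs) = leading + e0%:Z + c%:Z * (size fs)%:Z.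
  rewrite /psum1 !big_cons addrA; congr (_ + _).
  elim: fs {sz} => [|f fs IH] /=; first by rewrite big_nil mulr0.
  by rewrite !big_cons IH -addn1 PoszD; ring.
rewrite sz /leading; have : c = 1%N /\ l = 1%N \/ c = 2%N /\ l = 0%N by lia.
by case=> -[c1 l1]; move: e2E; rewrite c1 l1 dE; lia.
Qed.

Lemma psum2_paired_cons f fs :
  psum2 (paired (f :: fs)) = f ^+ 2 + (c%:Z - f) ^+ 2 + psum2 (paired fs).
Proof. by rewrite /psum2 /= !big_cons addrA. Qed.

Lemma psum2_vanishing fs :
  psum2 (vanishing_seq fs) = leading ^+ 2 + e0%:Z ^+ 2 + psum2 (paired fs).
Proof. by rewrite /psum2 !big_cons addrA. Qed.

Section Congruence.
Variable I : filtration K.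
Hypothesis It : I 0 t.
Hypothesis ItV : I 0 t^-1.
Hypothesis I1t : forall m, ~~ (n %| m)%N -> I 0 (1 - t ^+ m)^-1.
Hypothesis Iu : I 1 (t ^+ n - 1).
Hypothesis natK : forall m, (0 < m)%N -> m%:R != 0 :> K.
Hypothesis InatV : forall m, (0 < m)%N -> I 0 (m%:R^-1).

(** Replacing one pair (0, c) by (-1, c + 1) raises the sum of squares by
    2 c + 2. *)
Lemma undeformed_sum_level : I 3 (deformed_sum t n d p (nseq d.-1 0)).
Proof.
have -> : d.-1 = (2 * p).+2 by lia.
pose fs := nseq p (0 : int); pose fs' := (-1 : int) :: nseq p.-1 0.
have sz : size fs = p by rewrite size_nseq.
have sz' : size fs' = p by rewrite /= size_nseq; lia.
apply: (deformed_sum_level t0 t1 n_gt1 co_nd It ItV I1t Iu natK InatV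
  (es := vanishing_seq fs) (es' := vanishing_seq fs')).
- by rewrite size_vanishing sz.
- by rewrite size_vanishing sz'.
- exact: psum1_vanishing.
- exact: psum1_vanishing.
- rewrite !psum2_vanishing ltrD2l /fs /fs'; case: p p_gt0 => // p' _.
  rewrite [nseq p'.+1 0]/= !psum2_paired_cons ltrD2r !expr2; move: c_gt0; lia.
- exact: deformed_sum_eq0.
exact: deformed_sum_eq0.
Qed.

End Congruence.
End Vanishing.

(** * The filtration at the cyclotomic polynomial *)
Lemma polyfunM P R : polyfun (P * R) = polyfun P * polyfun R.
Proof. exact: rmorphM. Qed.

Lemma polyfunB P R : polyfun (P - R) = polyfun P - polyfun R.
Proof. exact: rmorphB. Qed.

Lemma polyfun1 : polyfun 1 = 1.
Proof. exact: rmorph1. Qed.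

Lemma polyfun_eq0 P : (polyfun P == 0) = (P == 0).
Proof. exact: tofrac_eq0. Qed.

Lemma polyfun_nat m : polyfun m%:R = m%:R.
Proof. exact: rmorph_nat. Qed.

Lemma polyfunXn m : polyfun 'X^m = q ^+ m.
Proof. exact: rmorphXn. Qed.

Lemma polyX_sub1_neq0 m : (0 < m)%N -> 1 - 'X^m != 0 :> {poly rat}.
Proof.
by move=> m0; rewrite -oppr_eq0 opprB -size_poly_eq0 size_XnsubC.
Qed.

Lemma q_neq0 : q != 0.
Proof. by rewrite polyfun_eq0 polyX_eq0. Qed.

Lemma q_pow_neq1 (E : int) : E != 0 -> q ^ E != 1.
Proof.
have h m : (0 < m)%N -> q ^+ m != 1.
  move=> m0; rewrite -subr_eq0 -oppr_eq0 opprB -polyfunXn -polyfun1 -polyfunB.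
  by rewrite polyfun_eq0 polyX_sub1_neq0.
case: E => m E0; first by apply: h; lia.
by rewrite NegzE -invr_expz invr_eq1; apply: h.
Qed.

Section PhiAdic.
Variable n : nat.
Notation Phi := (ratPhi n).

Definition phi_level (j : nat) (x : ratfun) :=
  exists U V : {poly rat},
    [/\ V != 0, coprimep V Phi & x = polyfun (Phi ^+ j * U) / polyfun V].

Lemma phi_level0 j : phi_level j 0.
Proof.
exists 0, 1; split; [exact: oner_neq0 | exact: coprime1p |].
by rewrite mulr0 /polyfun tofrac0 mul0r.
Qed.

Lemma phi_level1 : phi_level 0 1.
Proof.
exists 1, 1; split; [exact: oner_neq0 | exact: coprime1p |].
by rewrite expr0 mulr1 polyfun1 divr1.
Qed.

Lemma phi_levelD j x y : phi_level j x -> phi_level j y -> phi_level j (x + y).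
Proof.
move=> [U [V [V0 coV ->]]] [U' [V' [V'0 coV' ->]]].
exists (U * V' + U' * V), (V * V'); split; first exact: mulf_neq0.
  by rewrite coprimepMl coV.
rewrite addf_div ?polyfun_eq0 // -!polyfunM -[_ + _]rmorphD.
by rewrite mulrDr !mulrA.
Qed.

Lemma phi_levelN j x : phi_level j x -> phi_level j (- x).
Proof.
move=> [U [V [V0 coV ->]]]; exists (- U), V; split=> //.
by rewrite mulrN /polyfun rmorphN mulNr.
Qed.

Lemma phi_levelM i j x y :
  phi_level i x -> phi_level j y -> phi_level (i + j) (x * y).
Proof.
move=> [U [V [V0 coV ->]]] [U' [V' [V'0 coV' ->]]].
exists (U * U'), (V * V'); split; first exact: mulf_neq0.
  by rewrite coprimepMl coV.
by rewrite mulf_div -!polyfunM exprD mulrACA.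
Qed.

Lemma phi_levelW i j x : (i <= j)%N -> phi_level j x -> phi_level i x.
Proof.
move=> ij [U [V [V0 coV ->]]]; exists (Phi ^+ (j - i) * U), V; split=> //.
by rewrite mulrA -exprD subnKC.
Qed.

Definition phi_adic : filtration ratfun :=
  Filtration phi_level0 phi_level1 phi_levelD phi_levelN phi_levelM phi_levelW.

Lemma phi_level_eqmod0 j x : phi_level j x -> eqmod0 x (Phi ^+ j).
Proof.
by move=> [U [V [V0 coV ->]]]; exists U, V; split=> //; apply: coprimep_expr.
Qed.

Lemma phi_level_polyfun P : phi_level 0 (polyfun P).
Proof.
exists P, 1; split; [exact: oner_neq0 | exact: coprime1p |].
by rewrite expr0 mul1r polyfun1 divr1.
Qed.

Lemma phi_level_polyfunV P : P != 0 -> coprimep P Phi ->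
  phi_level 0 (polyfun P)^-1.
Proof.
move=> P0 coP; exists 1, P; split=> //.
by rewrite expr0 mulr1 polyfun1 mul1r.
Qed.

Hypothesis n_gt1 : (1 < n)%N.

(** Over the algebraic numbers the roots of Phi_n are the primitive n-th roots of
    unity. *)
Lemma coprimep_ratPhi P :
  (forall z : algC, n.-primitive_root z -> ~~ root (map_poly ratr P) z) ->
  coprimep P Phi.
Proof.
move=> hP; rewrite -(coprimep_map (@ratr algC)) coprimep_sym.
have [z prz] := C_prim_root_exists (ltnW n_gt1).
have -> : map_poly ratr Phi = cyclotomic z n :> {poly algC}.
  rewrite -(Cintr_Cyclotomic prz) /ratPhi -map_poly_comp.
  by apply: eq_map_poly => a /=; rewrite ratr_int.
apply/Pdiv.ClosedField.coprimepP => x; rewrite root_cyclotomic //.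
exact: hP.
Qed.

Lemma coprimep_Xn_ratPhi m : ~~ (n %| m)%N -> coprimep (1 - 'X^m) Phi.
Proof.
move=> nm; apply: coprimep_ratPhi => z prz.
rewrite rmorphB rmorph1 /= map_polyXn rootE !hornerE subr_eq0 eq_sym.
by rewrite -(prim_order_dvd prz).
Qed.

Lemma coprimep_X_ratPhi : coprimep 'X Phi.
Proof.
apply: coprimep_ratPhi => z prz; rewrite map_polyX rootX.
apply/eqP => z0; have := prim_expr_order prz.
by rewrite z0 expr0n; case: n n_gt1 => // n' _ /eqP; rewrite eq_sym oner_eq0.
Qed.

Lemma phi_level_q : phi_level 0 q.
Proof. exact: phi_level_polyfun. Qed.

Lemma phi_level_qV : phi_level 0 q^-1.
Proof.
by apply: phi_level_polyfunV; [rewrite polyX_eq0 | apply: coprimep_X_ratPhi].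
Qed.

Lemma phi_level_1qV m : ~~ (n %| m)%N -> phi_level 0 (1 - q ^+ m)^-1.
Proof.
move=> nm; rewrite -polyfunXn -polyfun1 -polyfunB.
apply: phi_level_polyfunV; last exact: coprimep_Xn_ratPhi.
by apply: polyX_sub1_neq0; case: m nm => //; rewrite dvdn0.
Qed.

Lemma phi_level_qn1 : phi_level 1 (q ^+ n - 1).
Proof.
have n0 := ltnW n_gt1.
have XP : 'X^n - 1 = Phi *
    map_poly intr (\prod_(e <- rem n (divisors n)) 'Phi_e) :> {poly rat}.
  have := prod_Cyclotomic n0; rewrite (big_rem n) /= -?dvdn_divisors // => XPZ.
  by rewrite /ratPhi -rmorphM XPZ rmorphB rmorph1 /= map_polyXn.
rewrite -polyfunXn -polyfun1 -polyfunB XP -[Phi]expr1.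
eexists; exists 1; split; [exact: oner_neq0 | exact: coprime1p |].
by rewrite polyfun1 divr1.
Qed.

Lemma phi_level_natV m : (0 < m)%N -> phi_level 0 (m%:R)^-1.
Proof.
move=> m0; have mr : (m%:R : rat) != 0 by rewrite pnatr_eq0 -lt0n.
have -> : (m%:R : ratfun) = polyfun (m%:R)%:P by rewrite rmorph_nat polyfun_nat.
apply: phi_level_polyfunV; first by rewrite polyC_eq0.
have mr1 : (m%:R)%:P %= (1 : {poly rat}) by rewrite polyC_eqp1.
by rewrite (eqp_coprimepl _ mr1) coprime1p.
Qed.
End PhiAdic.

Lemma ratfun_nat_neq0 m : (0 < m)%N -> m%:R != 0 :> ratfun.
Proof.
move=> m0; rewrite -polyfun_nat polyfun_eq0 -[m%:R](rmorph_nat polyC) polyC_eq0.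
by rewrite pnatr_eq0 -lt0n.
Qed.

(** * The congruences *)
Theorem theorem1 (d n : nat) (d_ge5 : (5 <= d)%N) (d_odd : odd d)
    (n_gt0 : (0 < n)%N) :
  let A : ratfun :=
    \sum_(0 <= k < n)
       qint (2 * d * k + 1)%N%:Z
       * (qpoch q (q ^+ d) k ^+ d / qpoch (q ^+ d) (q ^+ d) k ^+ d)
       * q ^+ ((d * (d - 3) * k) %/ 2)%N in
  ((n%:Z = -1 %[mod d%:Z])%Z -> eqmod0 A (ratPhi n ^+ 2)) /\
  (((2 * n)%N%:Z = -1 %[mod d%:Z])%Z -> eqmod0 A (ratPhi n ^+ 3)).
Proof.
move=> A; pose p := (d - 3)./2.
have dE : d = (2 * p + 3)%N by rewrite /p; lia.
have p_gt0 : (0 < p)%N by lia.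
suff main c : (0 < c)%N -> (c <= 2)%N -> ((c * n)%N%:Z = -1 %[mod d%:Z])%Z ->
    phi_level n 3 A.
  split=> hn; last exact: phi_level_eqmod0 (main 2 _ _ hn).
  apply: phi_level_eqmod0; apply: (@phi_levelW n 2 3) => //.
  by apply: (main 1) => //; rewrite mul1n.
(* modulo d, the two hypotheses read c n = -1 with c = 1 and c = 2 *)
move=> c_gt0 c_le2 /eqP; rewrite eqz_mod_dvd opprK => /dvdzP[r' hr'].
have [r dr] : exists r, (d * r = c * n + 1)%N.
  by exists `|r'|%N; nia.
pose l := (2 - c)%N; have cl : (c + l = 2)%N by rewrite /l; lia.
have [e2 e2E] : exists e2, (2 * e2 = c + d * l)%N.
  exists (c + d * l)./2; rewrite mul2n halfK.
  by case: c c_gt0 c_le2 {hr' dr} l cl => [|[|[|]]] //; lia.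
(* d is odd and d r = c n + 1, so r has the parity of c n + 1; as l and c have
   the same parity, r + l n is odd *)
have [h hE] : exists h, (2 * h + 1 = r + l * n)%N.
  exists (r + l * n)./2; suff odd_h : odd (r + l * n).
    by rewrite -[RHS]odd_double_half odd_h addnC mul2n.
  have odd_r : odd r = ~~ odd (c * n).
    by have := congr1 odd dr; rewrite oddM d_odd oddD addbT.
  have odd_l : odd l = odd c by have := congr1 odd cl; rewrite oddD; do 2 case: odd.
  by rewrite oddD odd_r !oddM odd_l; case: (_ && _).
have D := ShiftData dE p_gt0 c_gt0 cl dr e2E hE.
have n1 := n_gt1 D.
rewrite /A; have -> := undeformed_sumE q n dE.
apply: (@phi_levelM n 0 3).
  by apply: (@phi_level_1qV n n1 1); rewrite gtnNdvd.
exact: (undeformed_sum_level q_neq0 q_pow_neq1 D (I := phi_adic n)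
  (phi_level_q n) (phi_level_qV n1) (phi_level_1qV n1) (phi_level_qn1 n1)
  ratfun_nat_neq0 (@phi_level_natV n)).
Qed.
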